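(* Let $B$ be a poset and $A=At(B)$ the set of its atoms, i.e. of the minimal elements of $\check B$. Then the following conditions are equivalent: (a) $B$ is atomistic, i.e., each element of $B$ is a join of atoms. (b) $I_A=\{(a,a):a\in A\}$ is the neutral element of $B\,\check\otimes\,B$. (c) $B\,\check\otimes\,B$ (respectively, $B\otimes B$) has a neutral element. For bounded $B$, define $i_A:B\to B$ by $i_A(0_B)=1_B$, $i_A(a)=a$ for $a\in A$, and $i_A(x)=0_B$ otherwise. Then the previous conditions are equivalent to the following two: (d) The map $i_A$ is the neutral element of $Gal(B,B)$. (e) $Gal(B,B)$ has a neutral element.
   Context: For a poset $B$, let $\bot_B=\{0_B\}$ if $B$ has a least element $0_B$ and $\bot_B=\emptyset$ otherwise; $\check B=B\setminus\bot_B$. A poset is bounded if it has a least element $0_B$ and a greatest element $1_B$. For a subset $Y$ of a poset $P$, $\Delta_P Y=\bigcap\{\downarrow p: Y\subseteq\downarrow p\}$ (intersection over all principal ideals of $P$ containing $Y$; $P$ if there are none). $B\otimes B$ is the set, ordered by inclusion, of all $T\subseteq B\times B$ such that every slice $I=\{y:(x,y)\in T\}$ and $I=\{x:(x,y)\in T\}$ ($x$, resp. $y$, in $B$) satisfies $\Delta_B Y\subseteq I$ for all $Y\subseteq I$. $B\,\check\otimes\,B$ is the set, ordered by inclusion, of all $T\subseteq\check B\times\check B$ such that every slice $I=\{y:(x,y)\in T\}$ and $I=\{x:(x,y)\in T\}$ ($x$, resp. $y$, in $\check B$) satisfies $\Delta_{\check B}Y\subseteq I$ for all nonempty $Y\subseteq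 I$. Both are closed under arbitrary intersections. For $R,S\in B\,\check\otimes\,B$, the product $R\odot S$ is the least member of $B\,\check\otimes\,B$ containing $R\cdot S=\{(a,c):\exists b\ (a,b)\in R,(b,c)\in S\}$. With $\overline{\emptyset}=(\bot_B\times B)\cup(B\times\bot_B)$, the map $T\mapsto T\setminus\overline{\emptyset}$ is an isomorphism $B\otimes B\to B\,\check\otimes\,B$, and the multiplication of $B\otimes B$ is the transported one, $R\,\overline{\odot}\,S=((R\setminus\overline{\emptyset})\odot(S\setminus\overline{\emptyset}))\cup\overline{\emptyset}$. A neutral element is a two-sided unit for the multiplication. $Gal(B,B)$ is the pointwise ordered set of all Galois maps, i.e. maps $f:B\to B$ such that the preimage of any principal filter is a principal ideal; if $B$ is a complete lattice, these are the maps with $f(\bigvee X)=\bigwedge f[X]$ for all $X\subseteq B$. The product of $f,g\in Gal(B,B)$ is given by $g\odot f(a)=\bigvee\{c\in B:(a,c)\in E_{f,g}\}$, where $E_{f,g}$ is the least member of $B\otimes B$ containing $\{(x,z)\in B\times B:\exists y\in\check B\ (f(x)\ge y\text{ and }g(y)\ge z)\}$. For complete lattices this product is always defined; for a bounded $B$ that is not complete, the same formula is used whenever the joins in it exist, and $i$ is neutral if $i\odot f$ and $f\odot i$ exist and equal $f$ for all $f\in Gal(B,B)$. *)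

(* Defs.v *)
From mathcomp Require Import all_boot all_order.
From mathcomp Require Import boolp classical_sets.

Set Implicit Arguments.
Unset Strict Implicit.
Unset Printing Implicit Defensive.

Local Open Scope classical_set_scope.
Local Open Scope order_scope.

Definition is_neutral (X : Type) (M : set X) (mul : X -> X -> X) (e : X) : Prop :=
  M e /\ forall x, M x -> mul e x = x /\ mul x e = x.

Section Tensor.
Context {d : Order.disp_t} {B : porderType d}.
Implicit Types (a p x y z : B) (P Y : set B) (R S T : set (B * B)).

Definition pideal p : set B := [set x | x <= p].
Definition pfilter p : set B := [set x | p <= x].

(* The singleton of the least element of B, or set0 if there is none. *)
Definition bots : set B := lbound [set: B].

Definition punctured : set B := ~` bots.

Definition atoms : set B :=
  [set a | punctured a /\ forall x, punctured x -> x <= a -> x = a].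

Definition atomistic : Prop :=
  forall x, exists2 Y, Y `<=` atoms & isLub Y x.

(* The operator Delta of the subposet P of B, whose principal ideals are the
   sets P `&` pideal p with p in P; it equals P if none of them contains Y. *)
Definition Delta P Y : set B :=
  P `&` \bigcap_(p in [set p | P p /\ Y `<=` P `&` pideal p]) (P `&` pideal p).

Definition tensor : set (set (B * B)) :=
  [set T |
    (forall x Y, Y `<=` xsection T x -> Delta [set: B] Y `<=` xsection T x) /\
    (forall y Y, Y `<=` ysection T y -> Delta [set: B] Y `<=` ysection T y)].

Definition ctensor : set (set (B * B)) :=
  [set T | [/\ T `<=` punctured `*` punctured,
    (forall x Y, punctured x -> Y !=set0 -> Y `<=` xsection T x ->
       Delta punctured Y `<=` xsection T x) &
    (forall y Y, punctured y -> Y !=set0 -> Y `<=` ysection T y ->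
       Delta punctured Y `<=` ysection T y)]].

(* The notation "\;" of classical_sets takes its arguments in the opposite order. *)
Definition rel_mul R S : set (B * B) :=
  [set ac | exists b, R (ac.1, b) /\ S (b, ac.2)].

Definition ctensor_mul R S : set (B * B) := smallest ctensor (rel_mul R S).

Definition tensor_bot : set (B * B) := (bots `*` [set: B]) `|` ([set: B] `*` bots).

Definition tensor_mul R S : set (B * B) :=
  ctensor_mul (R `\` tensor_bot) (S `\` tensor_bot) `|` tensor_bot.

Definition atom_diag : set (B * B) := [set (a, a) | a in atoms].

Definition Gal : set (B -> B) :=
  [set f | forall b, exists p, f @^-1` (pfilter b) = pideal p].

Definition Gal_rel (f g : B -> B) : set (B * B) :=
  smallest tensor
    [set xz | exists2 y, punctured y & y <= f xz.1 /\ xz.2 <= g y].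

(* The product of g after f exists, i.e. all the joins defining
   it exist, and equals h. *)
Definition is_Gal_mul (g f h : B -> B) : Prop :=
  forall a, isLub [set c | Gal_rel f g (a, c)] (h a).

Definition is_Gal_neutral (i : B -> B) : Prop :=
  Gal i /\ forall f, Gal f -> is_Gal_mul i f f /\ is_Gal_mul f i f.

Definition atom_map (bot top : B) (x : B) : B :=
  if x == bot then top else if x \in atoms then x else bot.

End Tensor.

Arguments atoms {d} B.
Arguments atomistic {d} B.
Arguments tensor {d} B.
Arguments ctensor {d} B.
Arguments atom_diag {d} B.
Arguments Gal {d} B.

(* Main.v *)
Require Import Defs.
From mathcomp Require Import all_boot all_order.
From mathcomp Require Import boolp classical_sets.

(** The neutral element is forced to be the diagonal of the atoms, and this
    diagonal acts trivially exactly when every element can be recovered from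
    the atoms below it.

    A member of either tensor product is a relation whose slices are closed
    under cut closure: with a set, nonempty in the punctured case, they contain
    everything below all its upper bounds ([tensorP], [ctensorP]).  In
    particular they are lower sets which contain every existing join.

    If B is atomistic, the atom diagonal times S contains (a, c) for all (x, c)
    in S and all atoms a below x; as x is a join of such atoms, closing the
    slice at c recovers (x, c).  Hence the diagonal is neutral
    ([atomistic_neutral]).

    Conversely, let E be neutral.  The squares of punctured principal ideals are
    members of the tensor product, and E may not push them outside themselves.
    This forces E into the diagonal; as E has lower slices, it only relates atoms
    ([neutral_sub_atom_diag]).  If u bounds all the atoms below a non-least x,
    then E times the square of the ideal of x lands in the product of the ideals
    of u and x, so x <= u ([neutral_atomistic]).  Thus x is the join of the atoms
    below it.

    Removing the pairs with a least entry is a bijection between the two tensor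
    products that transports neutral elements ([tensor_neutral]).

    For Galois maps the argument is the same: f is replaced by its hypograph,
    which is a member of the tensor product ([Gal_hypograph]), and products of
    ideals by the step maps, which send the least element to the greatest one,
    all other elements below p to q and the rest to the least element.  If B is
    atomistic, the joins which define a product with the atom map are maxima, so
    they exist; conversely, a neutral map comes with the joins of all its
    products ([atomistic_Gal_neutral], [Gal_neutral_atomistic]). *)

Set Implicit Arguments.
Unset Strict Implicit.
Unset Printing Implicit Defensive.

Import Order.TTheory.

Local Open Scope order_scope.
Local Open Scope classical_set_scope.

Section Atomistic.
Context {d : Order.disp_t} {B : porderType d}.
Implicit Types (a b c p q u v x y z : B) (Y : set B) (R S T E : set (B * B)).
Implicit Types (f g i : B -> B).

Local Notation P := (@punctured d B).

(** * Cut closure and slices *)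

Lemma punctured_le x y : P x -> x <= y -> P y.
Proof. by move=> Px xy by0; apply: Px => z _; apply: le_trans xy (by0 z I). Qed.

Lemma Delta_setT Y z : Delta setT Y z <-> forall p, ubound Y p -> z <= p.
Proof.
split=> [[_ Yz] p Yp|Yz]; last by split=> // p [_ Yp]; split=> //; apply: Yz => y /Yp[].
by have [] := Yz p (conj I (fun y Yy => conj I (Yp y Yy))).
Qed.

(** An upper bound of a nonempty set of non-least elements is not least, so
    the cuts of B and of its punctured part agree on such sets. *)
Lemma Delta_punctured Y : Y !=set0 -> Y `<=` P ->
  Delta P Y = P `&` Delta setT Y.
Proof.
move=> [y0 Yy0] YP; apply/seteqP; split=> z [Pz Yz]; split=> //.
  apply/Delta_setT => p Yp.
  have Pp : P p by apply: punctured_le (Yp _ Yy0); apply: YP.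
  by have [|] := Yz p => //; split=> // y Yy; split; [exact: YP|exact: Yp].
move=> p [Pp Yp]; split=> //; move/Delta_setT: Yz; apply=> y /Yp[].
by [].
Qed.

Lemma tensorP T : tensor B T <->
  (forall x z Y, (forall y, Y y -> T (x, y)) ->
     (forall p, ubound Y p -> z <= p) -> T (x, z)) /\
  (forall y z Y, (forall x, Y x -> T (x, y)) ->
     (forall p, ubound Y p -> z <= p) -> T (z, y)).
Proof.
split=> [] [Tx Ty]; split.
- by move=> x z Y YT /Delta_setT Yz; apply/xsectionP; apply: Tx Yz => y /YT /xsectionP.
- by move=> y z Y YT /Delta_setT Yz; apply/ysectionP; apply: Ty Yz => x /YT /ysectionP.
- move=> x Y YT z /Delta_setT Yz; apply/xsectionP; apply: Tx Yz => y /YT.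
  by move/xsectionP.
- move=> y Y YT z /Delta_setT Yz; apply/ysectionP; apply: Ty Yz => x /YT.
  by move/ysectionP.
Qed.

Lemma ctensorP T : ctensor B T <->
  [/\ T `<=` P `*` P,
   forall x z Y, P z -> Y !=set0 -> (forall y, Y y -> T (x, y)) ->
     (forall p, ubound Y p -> z <= p) -> T (x, z) &
   forall y z Y, P z -> Y !=set0 -> (forall x, Y x -> T (x, y)) ->
     (forall p, ubound Y p -> z <= p) -> T (z, y)].
Proof.
split=> [] [TP Tx Ty]; split=> //.
- move=> x z Y Pz Y0 YT /Delta_setT Yz; apply/xsectionP.
  have [y0 /YT /TP[/= Px _]] := Y0.
  apply: (Tx x Y) => // [y /YT /xsectionP//|].
  by rewrite Delta_punctured// => y /YT /TP[].
- move=> y z Y Pz Y0 YT /Delta_setT Yz; apply/ysectionP.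
  have [x0 /YT /TP[/= _ Py]] := Y0.
  apply: (Ty y Y) => // [x /YT /ysectionP//|].
  by rewrite Delta_punctured// => x /YT /TP[].
- move=> x Y Px Y0 YT z; rewrite Delta_punctured//; last first.
    by move=> y /YT /xsectionP /TP[].
  move=> [Pz /Delta_setT Yz]; apply/xsectionP; apply: Tx Yz => // y /YT.
  by move/xsectionP.
- move=> y Y Py Y0 YT z; rewrite Delta_punctured//; last first.
    by move=> x /YT /ysectionP /TP[].
  move=> [Pz /Delta_setT Yz]; apply/ysectionP; apply: Ty Yz => // x /YT.
  by move/ysectionP.
Qed.

Lemma ctensor_lel T x x' y : ctensor B T -> P x' -> x' <= x -> T (x, y) -> T (x', y).
Proof.
move=> /ctensorP[_ _ Ty] Px' x'x Txy; apply: (Ty y x' [set x]) => //.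
- by exists x.
- by move=> _ ->.
- by move=> p /(_ x erefl); apply: le_trans.
Qed.

Lemma ctensor_ler T x y y' : ctensor B T -> P y' -> y' <= y -> T (x, y) -> T (x, y').
Proof.
move=> /ctensorP[_ Tx _] Py' y'y Txy; apply: (Tx x y' [set y]) => //.
- by exists y.
- by move=> _ ->.
- by move=> p /(_ y erefl); apply: le_trans.
Qed.

Lemma tensor_ler T x y y' : tensor B T -> y' <= y -> T (x, y) -> T (x, y').
Proof.
move=> /tensorP[Tx _] y'y Txy; apply: (Tx x y' [set y]) => [_ ->//|p].
by move=> /(_ y erefl); apply: le_trans.
Qed.

(** * Atoms *)

Lemma atom_le a b : atoms B a -> P b -> b <= a -> b = a.
Proof. by move=> [_]; apply. Qed.

(** A non-least element cannot be the join of the empty set, hence the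
    nonemptiness. *)
Lemma atomistic_join x : atomistic B -> P x ->
  exists Y, [/\ Y !=set0, forall a, Y a -> atoms B a /\ a <= x &
                forall p, ubound Y p -> x <= p].
Proof.
move=> /(_ x)[Y YA [Yx xY]] Px; exists Y; split=> //; last first.
  by move=> a Ya; split; [exact: YA|exact: Yx].
apply/set0P; apply/eqP => Y0; apply: Px => z _; apply: xY.
by rewrite Y0 => y [].
Qed.

(** The least element, if there is one, is the empty join; this leaves the
    non-least elements. *)
Lemma atomistic_intro :
  (forall x u, P x -> (forall a, atoms B a -> a <= x -> a <= u) -> x <= u) ->
  atomistic B.
Proof.
move=> H x; have [Px|/contrapT x0] := pselect (P x).
  exists [set a | atoms B a /\ a <= x]; first by move=> a [].
  split=> [a []//|u ub]; apply: H => // a Aa ax.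
  exact: ub.
by exists set0 => //; split=> [y []|u _]; exact: x0.
Qed.

(** * Neutral elements of the punctured tensor product *)

Lemma ctensor_box u v : ctensor B ([set z | P z /\ z <= u] `*` [set z | P z /\ z <= v]).
Proof.
apply/ctensorP; split=> [[x y] [[Px _] [Py _]]//|x z Y Pz [y Yy] YT Yz|y z Y Pz [x Yx] YT Yz].
  by have [/= xu _] := YT y Yy; split=> //=; split=> //; apply: Yz => t /YT[_ []].
by have [/= _ yv] := YT x Yx; split=> //=; split=> //; apply: Yz => t /YT[[]].
Qed.

Lemma ctensor_full : ctensor B (P `*` P).
Proof.
apply/ctensorP; split=> // [x z Y Pz [y Yy] YT _|y z Y Pz [x Yx] YT _].
  by have [] := YT y Yy.
by have [] := YT x Yx.
Qed.

Lemma ctensor_mul_sub R S T : ctensor B T -> rel_mul R S `<=` T ->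
  ctensor_mul R S `<=` T.
Proof. exact: smallest_sub. Qed.

Lemma sub_ctensor_mul R S : rel_mul R S `<=` ctensor_mul R S.
Proof. exact: sub_gen_smallest. Qed.

(** A slice of the atom diagonal is empty or a single atom a, and the only
    non-least element below a is a itself. *)
Lemma ctensor_atom_diag : ctensor B (atom_diag B).
Proof.
apply/ctensorP; split=> [_ [a [Pa _] <-]//|x z Y Pz [y Yy] YT Yz|y z Y Pz [x Yx] YT Yz].
  have [a Aa [ax _]] := YT y Yy; rewrite -{}ax {x} in YT *.
  exists a => //; congr pair; apply/esym/atom_le => //.
  by apply: Yz => t /YT[b _ [-> ->]].
have [a Aa [_ ay]] := YT x Yx; rewrite -{}ay {y} in YT *.
exists a => //; congr pair; apply/esym/atom_le => //.
by apply: Yz => t /YT[b _ [<- <-]].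
Qed.

Lemma atomistic_neutral : atomistic B ->
  is_neutral (ctensor B) ctensor_mul (atom_diag B).
Proof.
move=> at_; split=> [|S cS]; first exact: ctensor_atom_diag.
split; apply/seteqP; split.
- by apply: ctensor_mul_sub => // -[_ c] [_ /= [[a _ [<- <-]]]].
- move=> [x c] Sxc T [/= /ctensorP[_ _ Ty] ST].
  have /ctensorP[SP _ _] := cS; have [/= Px Pc] := SP _ Sxc.
  have [Y [Y0 Yx xY]] := atomistic_join at_ Px.
  apply: (Ty c x Y) => // a /Yx[Aa ax]; apply: ST; exists a; split; first by exists a.
  by apply: ctensor_lel Sxc => //; have [] := Aa.
- by apply: ctensor_mul_sub => // -[c x] [y /= [Scy [a _ [-> <-]]]].
- move=> [c x] Scx T [/= /ctensorP[_ Tx _] ST].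
  have /ctensorP[SP _ _] := cS; have [/= Pc Px] := SP _ Scx.
  have [Y [Y0 Yx xY]] := atomistic_join at_ Px.
  apply: (Tx c x Y) => // a /Yx[Aa ax]; apply: ST; exists a; split; last by exists a.
  by apply: ctensor_ler Scx => //; have [] := Aa.
Qed.

(** Squares of ideals force both a <= b and b <= a for (a, b) in E; applied to
    (x, a) with a non-least x below a, which is in E because slices are lower sets, this
    makes a an atom. *)
Lemma neutral_sub_atom_diag E : is_neutral (ctensor B) ctensor_mul E ->
  E `<=` atom_diag B.
Proof.
move=> [cE nE]; have /ctensorP[EP _ _] := cE.
have Ediag a b : E (a, b) -> a = b.
  move=> Eab; have [/= Pa Pb] := EP _ Eab.
  apply/eqP; rewrite eq_le; apply/andP; split.
    have [nb _] := nE _ (ctensor_box b b).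
    have : rel_mul E ([set z | P z /\ z <= b] `*` [set z | P z /\ z <= b]) (a, b).
      by exists b.
    by move=> /sub_ctensor_mul; rewrite nb => -[[]].
  have [_ na] := nE _ (ctensor_box a a).
  have : rel_mul ([set z | P z /\ z <= a] `*` [set z | P z /\ z <= a]) E (a, b).
    by exists a.
  by move=> /sub_ctensor_mul; rewrite na => -[_ []].
move=> [a b] Eab; have ab := Ediag _ _ Eab; rewrite -{}ab {b} in Eab *.
exists a => //; split=> [|x Px xa]; first by have [] := EP _ Eab.
exact: Ediag (ctensor_lel cE Px xa Eab).
Qed.

(** As E only relates atoms, it cannot distinguish the ideal of x from that of
    an upper bound u of the atoms below x. *)
Lemma neutral_atomistic E : is_neutral (ctensor B) ctensor_mul E -> atomistic B.
Proof.
move=> nE; have EA := neutral_sub_atom_diag nE.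
apply: atomistic_intro => x u Px xu; have [nx _] := nE.2 _ (ctensor_box x x).
have /(_ (x, x))[//|[]//] : [set z | P z /\ z <= x] `*` [set z | P z /\ z <= x] `<=`
    [set z | P z /\ z <= u] `*` [set z | P z /\ z <= x].
rewrite -[X in X `<=` _]nx; apply: ctensor_mul_sub; first exact: ctensor_box.
move=> [_ c] [_ /= [/EA[a Aa [<- <-]] [[Pa ax] xc]]].
by split=> //; split=> //; exact: xu.
Qed.

(** * Adding and removing the degenerate pairs *)

Lemma tensor_botP x y : tensor_bot (x, y) <-> ~ P x \/ ~ P y.
Proof.
rewrite /tensor_bot /punctured /=; split.
  by move=> [[x0 _]|[_ y0]]; [left; apply|right; apply].
by move=> [/contrapT x0|/contrapT y0]; [left|right].
Qed.

(** The slices contain the cut closure of the empty set, which consists of the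
    least element if there is one. *)
Lemma tensor_bot_sub T : tensor B T -> @tensor_bot d B `<=` T.
Proof.
move=> /tensorP[Tx Ty] [x y] [[/= x0 _]|[_ /= y0]].
  by apply: (Ty y x set0) => // p _; exact: x0.
by apply: (Tx x y set0) => // p _; exact: y0.
Qed.

Lemma ctensorD T : tensor B T -> ctensor B (T `\` tensor_bot).
Proof.
move=> /tensorP[Tx Ty].
have DP x y : (T `\` tensor_bot) (x, y) <-> [/\ T (x, y), P x & P y].
  split=> [[Txy /tensor_botP/not_orP[/contrapT Px /contrapT Py]]//|[Txy Px Py]].
  by split=> // /tensor_botP[].
apply/ctensorP; split=> [[x y] /DP[]//|x z Y Pz [y Yy] YT Yz|y z Y Pz [x Yx] YT Yz].
  apply/DP; have /DP[_ Px _] := YT y Yy; split=> //.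
  by apply: Tx Yz => t /YT/DP[].
apply/DP; have /DP[_ _ Py] := YT x Yx; split=> //.
by apply: Ty Yz => t /YT/DP[].
Qed.

Lemma ubound_punctured Y p : ubound (Y `&` P) p -> ubound Y p.
Proof.
move=> Yp y Yy; have [Py|/contrapT y0] := pselect (P y); first exact: Yp.
exact: y0.
Qed.

Lemma tensorU S : ctensor B S -> tensor B (S `|` tensor_bot).
Proof.
move=> /ctensorP[SP Sx Sy]; apply/tensorP.
(* With no non-least element in Y, each element is an upper bound of Y. *)
have nonempty Y z : P z -> (forall p, ubound Y p -> z <= p) -> (Y `&` P) !=set0.
  move=> Pz Yz; apply/set0P; apply/eqP => Y0; apply: Pz => p _.
  by apply/Yz/ubound_punctured; rewrite Y0 => y [].
split=> [x z Y YT Yz|y z Y YT Yz].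
  have [zx|/not_orP[/contrapT Px /contrapT Pz]] := pselect (~ P x \/ ~ P z).
    by right; apply/tensor_botP.
  left; apply: (Sx x z (Y `&` P)) => //; first exact: nonempty Yz.
    by move=> y [/YT[//|/tensor_botP[]]].
  by move=> p /ubound_punctured; exact: Yz.
have [zy|/not_orP[/contrapT Pz /contrapT Py]] := pselect (~ P z \/ ~ P y).
  by right; apply/tensor_botP.
left; apply: (Sy y z (Y `&` P)) => //; first exact: nonempty Yz.
  by move=> x [/YT[//|/tensor_botP[]]].
by move=> p /ubound_punctured; exact: Yz.
Qed.

Lemma tensorDK T : tensor B T -> (T `\` tensor_bot) `|` tensor_bot = T.
Proof. by move=> /tensor_bot_sub; exact: setDKU. Qed.

Lemma puncturedUK S : S `<=` P `*` P -> (S `|` tensor_bot) `\` tensor_bot = S.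
Proof. by move=> SP; apply: setUDK => -[x y] [/tensor_botP ? /SP[]]; tauto. Qed.

Lemma ctensorUK S : ctensor B S -> (S `|` tensor_bot) `\` tensor_bot = S.
Proof. by move=> /ctensorP[/puncturedUK]. Qed.

Lemma ctensor_mul_punctured R S : ctensor B R -> ctensor B S ->
  ctensor_mul R S `<=` P `*` P.
Proof.
move=> /ctensorP[RP _ _] /ctensorP[SP _ _].
apply: ctensor_mul_sub; first exact: ctensor_full.
by move=> [x z] [y /= [/RP[Px _] /SP[_ Pz]]].
Qed.

Lemma tensor_neutral :
  (exists E, is_neutral (ctensor B) ctensor_mul E) <->
  (exists E, is_neutral (tensor B) tensor_mul E).
Proof.
split=> [[E [cE nE]]|[E [tE nE]]].
  exists (E `|` tensor_bot); split=> [|T tT]; first exact: tensorU.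
  rewrite /tensor_mul ctensorUK//.
  by have [-> ->] := nE _ (ctensorD tT); rewrite tensorDK.
exists (E `\` tensor_bot); have cE := ctensorD tE; split=> // S cS.
have [nl nr] := nE _ (tensorU cS).
rewrite /tensor_mul ctensorUK// in nl nr.
split; first by rewrite -[LHS]puncturedUK ?nl ?ctensorUK//; exact: ctensor_mul_punctured.
by rewrite -[LHS]puncturedUK ?nr ?ctensorUK//; exact: ctensor_mul_punctured.
Qed.

(** * Galois maps *)

Lemma Gal_anti f x y : Gal B f -> x <= y -> f y <= f x.
Proof.
move=> /(_ (f y))[p fp] xy.
have yp : (f @^-1` pfilter (f y)) y by rewrite /preimage /pfilter /=.
have : (f @^-1` pfilter (f y)) x by move: yp; rewrite fp; exact: le_trans.
by [].
Qed.

Definition hypograph f : set (B * B) := [set xy | xy.2 <= f xy.1].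

(** The slices of the hypograph are the principal ideals of f x and the
    preimages of principal filters: exactly the Galois condition. *)
Lemma Gal_hypograph f : Gal B f -> tensor B (hypograph f).
Proof.
move=> Gf; apply/tensorP; split=> [x z Y YT|y z Y YT Yz]; first by apply=> y /YT.
have [p fp] := Gf y.
have fpE x : (y <= f x) = (x <= p) :> Prop := congr1 (@^~ x) fp.
rewrite /hypograph /= fpE; apply: Yz => x /YT.
by rewrite /hypograph /= fpE.
Qed.

Lemma Gal_mul_hypograph f g h : (forall a c, Gal_rel f g (a, c) <-> c <= h a) ->
  is_Gal_mul g f h.
Proof. by move=> fgh a; split=> [c /fgh//|u]; apply; apply/fgh. Qed.

Lemma Gal_mul_le f g h x y z : is_Gal_mul g f h ->
  P y -> y <= f x -> z <= g y -> z <= h x.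
Proof. by move=> /(_ x)[fgh _] Py yfx zgy; apply: fgh; apply: sub_gen_smallest; exists y. Qed.

Section Bounded.
Variables bot top : B.
Hypotheses (bot_le : forall x, bot <= x) (le_top : forall x, x <= top).

Lemma puncturedE x : P x <-> x <> bot.
Proof.
split=> [Px xE|xb x0]; first by apply: Px => y _; rewrite xE; exact: bot_le.
by apply: xb; apply/eqP; rewrite eq_le bot_le andbT; exact: x0.
Qed.

Lemma le_bot x : x <= bot -> x = bot.
Proof. by move=> xb; apply/eqP; rewrite eq_le xb bot_le. Qed.

Lemma Gal_bot f : Gal B f -> f bot = top.
Proof.
move=> /(_ top)[p fp]; apply/eqP; rewrite eq_le le_top /=.
have : (f @^-1` pfilter top) bot by rewrite fp; exact: bot_le.
by [].
Qed.

(** The Galois counterpart of the product of the ideals of p and q. *)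
Definition step p q x : B :=
  if x == bot then top else if x <= p then q else bot.

Lemma Gal_step p q : Gal B (step p q).
Proof.
move=> b.
have [->|/eqP bb] := eqVneq b bot.
  by exists top; apply/seteqP; split=> x _; [exact: le_top|exact: bot_le].
have [bq|bq] := boolP (b <= q).
  exists p; apply/seteqP; split=> x; rewrite /preimage /pfilter /pideal /step /=.
    case: eqP => [-> _|_]; first exact: bot_le.
    by case: ifP => // _ /le_bot.
  by case: eqP => // _ ->.
exists bot; apply/seteqP; split=> x; rewrite /preimage /pfilter /pideal /step /=.
  case: eqP => [->//|_].
  by case: ifP => _; [rewrite (negbTE bq)|move=> /le_bot].
by move=> /le_bot ->; rewrite eqxx.
Qed.

Lemma step_nbot p q x : P x -> step p q x = if x <= p then q else bot.
Proof. by move=> /puncturedE /eqP/negbTE xb; rewrite /step xb. Qed.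

(** The preimage of the filter of b is the ideal of b if b is an atom, and the
    ideal of the least element if b is any other non-least element. *)
Lemma Gal_atom_map : Gal B (atom_map bot top).
Proof.
move=> b.
have [->|/eqP/puncturedE Pb] := eqVneq b bot.
  by exists top; apply/seteqP; split=> x _; [exact: le_top|exact: bot_le].
have [Ab|nAb] := pselect (atoms B b).
  exists b; apply/seteqP; split=> x; rewrite /preimage /pfilter /pideal /atom_map /=.
    case: eqP => [-> _|_]; first exact: bot_le.
    case: ifP => [/set_mem Ax bx|_ /le_bot /(proj1 (puncturedE b) Pb)//].
    by rewrite (atom_le Ax Pb bx).
  case: eqP => [//|/puncturedE Px xb]; have xbE := atom_le Ab Px xb.
  by rewrite xbE mem_set.
exists bot; apply/seteqP; split=> x; rewrite /preimage /pfilter /pideal /atom_map /=.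
  case: eqP => [->//|_].
  case: ifP => [/set_mem Ax bx|_ /le_bot /(proj1 (puncturedE b) Pb)//].
  by case: nAb; rewrite (atom_le Ax Pb bx).
by move=> /le_bot ->; rewrite eqxx.
Qed.

Lemma atom_map_atom a : atoms B a -> atom_map bot top a = a.
Proof.
move=> Aa; have [/puncturedE/eqP/negbTE ab _] := Aa.
by rewrite /atom_map ab mem_set.
Qed.

Lemma le_atom_map y x : P x -> P y -> y <= atom_map bot top x -> atoms B x /\ y = x.
Proof.
move=> /puncturedE/eqP/negbTE xb Py; rewrite /atom_map xb.
case: ifP => [/set_mem Ax yx|_ /le_bot /(proj1 (puncturedE y) Py)//].
by split=> //; exact: atom_le.
Qed.

Lemma atomistic_Gal_neutral : atomistic B -> is_Gal_neutral (atom_map bot top).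
Proof.
move=> at_; split=> [|f Gf]; first exact: Gal_atom_map.
have tf := Gal_hypograph Gf.
split; apply: Gal_mul_hypograph => x z; split.
- move: (x) (z) => {x z} x z fxz; apply: (smallest_sub tf _ fxz) => {fxz}.
  move=> [{}x {}z] [y Py /= [yfx]]; rewrite /hypograph /=.
  have [->|/eqP/puncturedE Pz] := eqVneq z bot; first by move=> _; exact: bot_le.
  by move=> /(le_atom_map Py Pz)[_ ->].
- move=> zfx T [/= tT fT]; apply: (tensor_ler tT zfx) => {z zfx}.
  have [Y YA [Yf fY]] := at_ (f x); have [Tx _] := proj1 (tensorP T) tT.
  apply: (Tx x (f x) Y) => // a Ya; have Aa := YA _ Ya.
  apply: fT; exists a; first by have [] := Aa.
  by split; [exact: Yf|rewrite atom_map_atom].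
- move=> fxz; apply: (smallest_sub tf _ fxz) => {x z fxz} -[x z] [y Py /= [yx zy]].
  rewrite /hypograph /=; have [->|/eqP/puncturedE Px] := eqVneq x bot.
    by rewrite Gal_bot.
  by have [_ <-] := le_atom_map Px Py yx.
- move=> zfx T [/= tT fT]; have [Y YA [Yx xY]] := at_ x.
  have [_ Ty] := proj1 (tensorP T) tT.
  apply: (Ty z x Y) => // a Ya; have Aa := YA _ Ya.
  apply: fT; exists a; first by have [] := Aa.
  by split; [rewrite atom_map_atom|exact: le_trans zfx (Gal_anti Gf (Yx _ Ya))].
Qed.

(** Testing i against step maps shows that i z <= z for non-least z and that
    every non-least element below i x equals x, so i agrees with the atom map
    wherever it does not take the least value. *)
Lemma Gal_neutral_atom i x y : is_Gal_neutral i ->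
  P x -> P y -> y <= i x -> atoms B x /\ y = x.
Proof.
move=> [_ ni] Px Py yix.
have Ptop : P top by exact: punctured_le Px (le_top x).
have ile z : P z -> i z <= z.
  (* The value at top of the product of i with step top z is again z. *)
  move=> Pz; have [ni1 _] := ni _ (Gal_step top z).
  have := Gal_mul_le (z := i z) (x := top) ni1 Pz.
  by rewrite step_nbot// le_top; apply.
have lex t : P t -> t <= i x -> t = x.
  move=> Pt tix; apply/eqP; rewrite eq_le (le_trans tix (ile _ Px)) /=.
  (* If x were not below t, the product of step t top with i would be least at
     x, although t <= i x makes it top. *)
  have [_ ni2] := ni _ (Gal_step t top).
  have := Gal_mul_le (z := top) ni2 Pt tix.
  rewrite !step_nbot// lexx => /(_ (lexx _)).
  by case: ifP => // _ /le_bot /(proj1 (puncturedE top) Ptop).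
have yx := lex _ Py yix; split=> //; split=> // t Pt tx.
by apply: lex => //; apply: le_trans tx _; rewrite -{1}yx.
Qed.

(** The product with i of the step map with value x lies below the step map with
    value u, for any upper bound u of the atoms below x. *)
Lemma Gal_neutral_atomistic i : is_Gal_neutral i -> atomistic B.
Proof.
move=> ni; apply: atomistic_intro => x u Px xu.
have Ptop : P top by exact: punctured_le Px (le_top x).
have [/(_ top)[_]] := ni.2 _ (Gal_step top x); rewrite step_nbot// le_top => + _.
apply=> c fic.
have : hypograph (step top u) (top, c).
  apply: (smallest_sub (Gal_hypograph (Gal_step top u)) _ fic) => {fic c} -[t c].
  move=> [y Py /= [+ ciy]]; rewrite /hypograph /=.
  have [->|/eqP/puncturedE Pt] := eqVneq t bot; first by rewrite {2}/step eqxx.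
  rewrite !step_nbot// le_top => yx.
  have [->|/eqP/puncturedE Pc] := eqVneq c bot; first exact: bot_le.
  by have [Ay ->] := Gal_neutral_atom ni Py Pc ciy; exact: xu.
by rewrite /hypograph /= step_nbot// le_top.
Qed.

End Bounded.
End Atomistic.

Theorem proposition9p1 (d : Order.disp_t) (B : porderType d) :
  [/\ atomistic B <-> is_neutral (ctensor B) ctensor_mul (atom_diag B),
      atomistic B <-> (exists E, is_neutral (ctensor B) ctensor_mul E) &
      atomistic B <-> (exists E, is_neutral (tensor B) tensor_mul E)] /\
  (forall bot top : B,
     (forall x : B, (bot <= x)%O) -> (forall x : B, (x <= top)%O) ->
     (atomistic B <-> is_Gal_neutral (atom_map bot top)) /\
     (atomistic B <-> exists i : B -> B, is_Gal_neutral i)).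
Proof.
have ex : atomistic B <-> exists E, is_neutral (ctensor B) ctensor_mul E.
  split=> [/atomistic_neutral|[E]]; last exact: neutral_atomistic.
  by exists (atom_diag B).
split=> [|bot top bot_le le_top].
  split=> //; last by rewrite -tensor_neutral.
  by split=> [|nE]; [exact: atomistic_neutral|exact: neutral_atomistic nE].
split.
  split=> [|ni]; first exact: atomistic_Gal_neutral.
  exact: (Gal_neutral_atomistic bot_le le_top ni).
split=> [|[i]]; last exact: Gal_neutral_atomistic.
by exists (atom_map bot top); exact: atomistic_Gal_neutral.
Qed.
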